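(* Let $A=\{A_n\}_{n\ge 0}$ be a finitely supported complex sequence with $A_0=0$, and let $S_n=\frac{n(n+1)}{2}$ for $n\ge1$. Then for any $\alpha\in[0,1)$, $$\sum_{n=1}^{\infty}\frac{S_n^{\alpha}|A_n-A_{n-1}|^2}{n}\ \ge\ \sum_{n=1}^{\infty}w_n(n,S)|A_n|^2\ >\ \frac{(\alpha-1)^2}{4}\sum_{n=1}^{\infty}\frac{n}{S_n^{2-\alpha}}|A_n|^2,$$ where, for $n\ge1$, $$w_n(n,S)=\frac{S_n^{\alpha}}{n}\Big[1+\frac{n}{n+1}\Big(\frac{n+2}{n}\Big)^{\alpha}-\Big(\frac{n-1}{n+1}\Big)^{\frac{1-\alpha}{2}}-\frac{n}{n+1}\Big(\frac{n+2}{n}\Big)^{\frac{1+\alpha}{2}}\Big].$$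
   Context: A sequence $\{A_n\}_{n\ge0}$ is finitely supported if $A_n\ne0$ for only finitely many $n$.
   Formalization: The strict inequality is stated only for sequences A that are not identically zero, since for A = 0 all sums vanish and the strict inequality fails; the first inequality is stated for all A. *)

(* Defs.v *)
From HB Require Import structures.
From mathcomp Require Export all_boot all_order all_algebra.
From mathcomp Require Export complex.
From mathcomp Require Export all_classical all_reals all_analysis.
Set Implicit Arguments.
Unset Strict Implicit.
Unset Printing Implicit Defensive.
Import Order.TTheory GRing.Theory Num.Theory.
Import numFieldNormedType.Exports.
Local Open Scope classical_set_scope.
Local Open Scope ring_scope.

(* The library has this notation only in ereal_scope. *)
Notation "\sum_ ( m <= i <oo ) F" :=
  (\big[+%R/0%R]_(m <= i <oo) F%R) : ring_scope.

Definition finitely_supported (V : nmodType) (A : nat -> V) : Prop :=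
  finite_set [set n | A n != 0].

(* [`|z|] has type [R[i]]; [cabs z] is the same modulus as an element of [R]. *)
Definition cabs (R : realType) (z : R[i]) : R := ComplexField.Normc.normc z.

Lemma cabsE (R : realType) (z : R[i]) : (cabs z)%:C%C = `|z|.
Proof. by []. Qed.

Definition S_ (R : realType) (n : nat) : R := n%:R * n.+1%:R / 2.

(* For n = 1 the third term is [0 `^ ((1 - alpha) / 2)], which is 0 because
   alpha < 1 makes the exponent nonzero.  The value at n = 0 is irrelevant. *)
Definition w_ (R : realType) (alpha : R) (n : nat) : R :=
  S_ R n `^ alpha / n%:R *
    (1 + n%:R / n.+1%:R * (n.+2%:R / n%:R) `^ alpha
     - ((n%:R - 1) / n.+1%:R) `^ ((1 - alpha) / 2)
     - n%:R / n.+1%:R * (n.+2%:R / n%:R) `^ ((1 + alpha) / 2)).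

(* Main.v *)
(** With [a n = S_n^alpha / n], [b = (1 - alpha) / 2] and [u n = S_n^b], the
    weight [w_n] equals
    [a n * (1 - u (n-1) / u n) + a (n+1) * (1 - u (n+1) / u n)], so the first
    inequality is the discrete ground-state estimate
    [|x - y|^2 >= (1 - t) |x|^2 + (1 - 1/t) |y|^2], taken at
    [t = u (n-1) / u n] and summed by parts.

    The second inequality holds term by term.  With [x = 1 / (n+1)] and
    [z = ((1 - x) / (1 + x))^b] it reads
    [1 - (1 - 2x)^b - (1 + x) (z - z^2) > 4 b^2 x^2].  Both sides agree up to
    order [x^2]; for [x <= 1/3] the powers are replaced by third-order
    polynomial bounds, the coefficient of [x^3] in [z] being chosen slightly
    below the Taylor one, which leaves a positive multiple of [b x^3].  The
    case [n = 1] is elementary. *)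
Require Import Defs.
From mathcomp Require Import ring lra.
Set Implicit Arguments.
Unset Strict Implicit.
Import Order.TTheory GRing.Theory Num.Theory.
Import numFieldNormedType.Exports.
Local Open Scope ring_scope.

(** * Polynomial bounds for powers *)

(** The derivative of [f * exp (- g)] is [(f' - g' * f) * exp (- g) >= 0]. Power bounds thus reduce
    to a polynomial inequality. *)
Lemma exp_comparison (R : realType) (f f' g g' : R -> R) (x : R) : 0 <= x ->
  (forall y, 0 <= y <= x -> is_derive y (1 : R) f (f' y)) ->
  (forall y, 0 <= y <= x -> is_derive y (1 : R) g (g' y)) ->
  (forall y, 0 <= y <= x -> g' y * f y <= f' y) ->
  f 0 * expR (- g 0) <= f x * expR (- g x).
Proof.
rewrite le_eqVlt => /predU1P[<- //|x_gt0] f_der g_der le_f'.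
pose h y := f y * expR (- g y).
pose h' y := (f' y - g' y * f y) * expR (- g y).
have h_der y : 0 <= y <= x -> is_derive y (1 : R) h (h' y).
  move=> yI; have Df := f_der y yI; have Dg := g_der y yI.
  have De : is_derive y (1 : R) (fun y => expR (- g y)) (expR (- g y) * - g' y).
    by apply: is_derive_eq; rewrite /= mulrC.
  apply: is_derive_eq; rewrite /h' /GRing.scale /=; ring.
have [||c cI h_mvt] := @MVT R h h' 0 x x_gt0.
- by move=> y; rewrite in_itv /= => /andP[y0 yx]; apply: h_der; rewrite !ltW.
- apply: derivable_within_continuous => y; rewrite in_itv /= => yI.
  by have [] := h_der y yI.
rewrite -/(h 0) -/(h x) -subr_ge0 h_mvt subr0.
have {}cI : 0 <= c <= x by move: cI; rewrite in_itv /= => /andP[? ?]; rewrite !ltW.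
by rewrite mulr_ge0 ?(ltW x_gt0) // mulr_ge0 ?expR_ge0 // subr_ge0 le_f'.
Qed.

(** The right side is the third Taylor polynomial [f] of the power; [(1 - y) * f' + b * f] is a
    single nonnegative [y ^+ 3] term. *)
Lemma powR_1B_le (R : realType) (b y : R) : 0 <= b -> b <= 1 -> 0 <= y -> y < 1 ->
  (1 - y) `^ b <= 1 - b * y - b * (1 - b) / 2 * y ^+ 2
                  - b * (1 - b) * (2 - b) / 6 * y ^+ 3.
Proof.
move=> b_ge0 b_le1 y_ge0 y_lt1.
pose f z := 1 - b * z - b * (1 - b) / 2 * z ^+ 2 - b * (1 - b) * (2 - b) / 6 * z ^+ 3.
pose f' z := - b - b * (1 - b) * z - b * (1 - b) * (2 - b) / 2 * z ^+ 2.
pose g z := b * ln (1 - z).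
pose g' z := - b / (1 - z).
have /= := @exp_comparison R f f' g g' y y_ge0.
have -> : f 0 * expR (- g 0) = 1.
  have -> : g 0 = 0 by rewrite /g subr0 ln1 mulr0.
  by rewrite oppr0 expR0 /f; ring.
have y1_gt0 : 0 < 1 - y by lra.
rewrite expRN ler_pdivlMr ?expR_gt0 // mul1r /powR gt_eqF // => le_f; apply: le_f => // z /andP[z0 zy].
- by apply: is_derive_eq; rewrite /f' /GRing.scale /=; field.
- have z1_gt0 : 0 < 1 - z by lra.
  have Dln := is_derive1_ln z1_gt0.
  by apply: is_derive_eq; rewrite /g' /GRing.scale /=; ring.
have z1_gt0 : 0 < 1 - z by lra.
rewrite /g' mulrAC ler_pdivrMr // -subr_ge0.
have -> : f' z * (1 - z) - - b * f z =
    b * (1 - b) * (2 - b) * (3 - b) / 6 * z ^+ 3 by rewrite /f /f'; field.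
by rewrite mulr_ge0 ?exprn_ge0 // divr_ge0 // !mulr_ge0 //; lra.
Qed.

Lemma powR_cayley_ge (R : realType) (b x : R) :
  0 <= b -> b <= 1/2 -> 0 <= x -> x <= 1/3 ->
  1 - 2 * b * x + 2 * b ^+ 2 * x ^+ 2 - (3/4 * b + 4/3 * b ^+ 3) * x ^+ 3
    <= ((1 - x) / (1 + x)) `^ b.
Proof.
move=> b_ge0 b_le x_ge0 x_le.
pose c := 3/4 * b + 4/3 * b ^+ 3.
(* The polynomial is negated because the comparison bounds [f] from below. The Taylor coefficient
   would be [2/3 * b + 4/3 * b ^+ 3]; [c] exceeds it by [b / 12]. *)
pose f z := 2 * b * z - 2 * b ^+ 2 * z ^+ 2 + c * z ^+ 3 - 1.
pose f' z := 2 * b - 4 * b ^+ 2 * z + 3 * c * z ^+ 2.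
pose g z := b * (ln (1 - z) - ln (1 + z)).
pose g' z := - (2 * b) / (1 - z ^+ 2).
have /= := @exp_comparison R f f' g g' x x_ge0.
have -> : f 0 * expR (- g 0) = -1.
  have -> : g 0 = 0 by rewrite /g subr0 addr0 ln1 subrr mulr0.
  by rewrite oppr0 expR0 /f; ring.
have xm : 0 < 1 - x by lra.
have xp : 0 < 1 + x by lra.
rewrite expRN ler_pdivlMr ?expR_gt0 // mulN1r /powR gt_eqF ?divr_gt0 //.
rewrite ln_div ?posrE // -/(g x) => le_f.
suff: - expR (g x) <= f x by rewrite /f /c; lra.
apply: le_f => // z /andP[z0 zx].
- by apply: is_derive_eq; rewrite /f' /GRing.scale /=; field.
- have zm : 0 < 1 - z by lra.
  have zp : 0 < 1 + z by lra.
  have Dm := is_derive1_ln zm; have Dp := is_derive1_ln zp.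
  apply: is_derive_eq; rewrite /g' /GRing.scale /=; field.
  have z2 : 1 - z ^+ 2 = (1 - z) * (1 + z) by ring.
  by rewrite z2 ?mulf_neq0 !gt_eqF.
have z2_gt0 : 0 < 1 - z ^+ 2 by nra.
rewrite /g' mulrAC ler_pdivrMr // -subr_ge0.
have -> : f' z * (1 - z ^+ 2) - - (2 * b) * f z = z ^+ 2 *
  - (b * (-1/4) + z * (-4 * b ^+ 2 - 2 * b * c) + 3 * c * z ^+ 2).
  by rewrite /f /f' /c; field.
rewrite mulr_ge0 ?sqr_ge0 // oppr_ge0 /c.
(* The excess in [c] yields the term [b / 4], which absorbs [9/4 * b * z ^+ 2] exactly when
   [z <= 1/3]; the rest of [3 * c * z ^+ 2] is absorbed by [4 * b ^+ 2 * z]. *)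
have zb : 0 <= z * b by nra.
have z29 : b * (9 * z ^+ 2 - 1) <= 0 by nra.
have h3 : 0 <= z * b * (b - b ^+ 2 * z) by apply: mulr_ge0; nra.
have h4 : 0 <= z * b ^+ 2 by nra.
have h5 : 0 <= z * b ^+ 2 * b ^+ 2 by nra.
by nra.
Qed.

(** The expression decreases in [x], so [x = 1/3] is the worst case and leaves a cubic in [b]. It is
    the main part of the coefficient of [b * x ^+ 3] left over in [weight_ineq]. *)
Lemma weight_margin_gt0 (R : realFieldType) (b x : R) :
  0 <= b -> b <= 1/2 -> 0 <= x -> x <= 1/3 ->
  0 < 23/12 + 2 * b - 8 * b ^+ 2 - x * (3/4 + 28/3 * b ^+ 2 - 4 * b ^+ 3).
Proof.
move=> b_ge0 b_le x_ge0 x_le.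
have : 0 <= (1/3 - x) * (3/4 + 28/3 * b ^+ 2 - 4 * b ^+ 3) by apply: mulr_ge0; nra.
suff : 0 < 23/12 + 2 * b - 8 * b ^+ 2 - 1/3 * (3/4 + 28/3 * b ^+ 2 - 4 * b ^+ 3) by lra.
by nra.
Qed.

Lemma weight_ineq (R : realType) (b x : R) : 0 < b -> b <= 1/2 -> 0 < x -> x <= 1/3 ->
  4 * b ^+ 2 * x ^+ 2 <
  1 + (1 + x) * (((1 - x) / (1 + x)) `^ b) ^+ 2 - (1 - 2 * x) `^ b
    - (1 + x) * ((1 - x) / (1 + x)) `^ b.
Proof.
move=> b_gt0 b_le x_gt0 x_le; set z := ((1 - x) / (1 + x)) `^ b.
have ule : (1 - 2 * x) `^ b <= 1 - 2 * b * x - 2 * b * (1 - b) * x ^+ 2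
             - 4/3 * b * (1 - b) * (2 - b) * x ^+ 3.
  apply: le_trans (powR_1B_le _ _ _ _) _; rewrite ?(ltW b_gt0) //; lra.
have zge := powR_cayley_ge (ltW b_gt0) b_le (ltW x_gt0) x_le.
rewrite -/z in zge.
(* [1 - d] is the cubic lower bound for [z], and [d0] is its defect up to order two. Using [d0 ^+ 2]
   for [d ^+ 2] keeps the degree low. *)
pose d0 := 2 * b * x - 2 * b ^+ 2 * x ^+ 2.
pose d := d0 + (3/4 * b + 4/3 * b ^+ 3) * x ^+ 3.
have bx : 0 < b * x by nra.
have bx6 : b * x <= 1/6 by nra.
have c_le : (3/4 * b + 4/3 * b ^+ 3) * x ^+ 3 <= b * x / 4.
  have -> : (3/4 * b + 4/3 * b ^+ 3) * x ^+ 3 =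
    b * x * ((3/4 + 4/3 * b ^+ 2) * x ^+ 2) by ring.
  rewrite ler_pM2l //; nra.
have d0_ge0 : 0 <= d0 by rewrite /d0; nra.
have d_ge : d0 <= d.
  rewrite /d lerDl mulr_ge0 ?exprn_ge0 ?(ltW x_gt0) //.
  by rewrite addr_ge0 // mulr_ge0 ?exprn_ge0 ?(ltW b_gt0) //; lra.
have d_le : d <= 1/2 by rewrite /d /d0; nra.
have zd : 1 - d <= z by rewrite /d /d0; lra.
(* z - z^2 is decreasing for z >= 1/2 *)
have z_le : z - z ^+ 2 <= d - d0 ^+ 2.
  have : 0 <= (z - (1 - d)) * (z - d) by apply: mulr_ge0; lra.
  have : d0 ^+ 2 <= d ^+ 2 by rewrite ler_pXn2r ?nnegrE //; lra.
  by nra.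
have z_le' : (1 + x) * (z - z ^+ 2) <= (1 + x) * (d - d0 ^+ 2) by rewrite ler_pM2l //; lra.
have := weight_margin_gt0 (ltW b_gt0) b_le (ltW x_gt0) x_le.
set G := (X in 0 < X) => G_gt0.
have main : 0 < b * x ^+ 3 * (G + 4 * b ^+ 3 * x ^+ 2).
  rewrite mulr_gt0 //; first by rewrite mulr_gt0 ?exprn_gt0.
  by rewrite ltr_wpDr // mulr_ge0 ?sqr_ge0 // mulr_ge0 ?exprn_ge0 ?(ltW b_gt0).
(* All terms below order [x ^+ 3] cancel. *)
have E : b * x ^+ 3 * (G + 4 * b ^+ 3 * x ^+ 2) =
  2 * b * x + 2 * b * (1 - b) * x ^+ 2 + 4/3 * b * (1 - b) * (2 - b) * x ^+ 3
  - (1 + x) * (d - d0 ^+ 2) - 4 * b ^+ 2 * x ^+ 2.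
  by rewrite /G /d /d0; field.
lra.
Qed.

(** * Finite support and summation by parts *)

Lemma series_finite_support (R : realType) (F : nat -> R) (m N : nat) :
  (m <= N)%N -> (forall n, (N <= n)%N -> F n = 0) ->
  \sum_(m <= n <oo) F n = \sum_(m <= n < N) F n.
Proof.
move=> mN F0; apply: norm_lim_near_cst; near=> k.
have Nk : (N <= k)%N by near: k; exists N.
rewrite (big_cat_nat mN Nk) /= [X in _ + X]big1_seq /= ?addr0 // => n.
by rewrite mem_index_iota => /andP[/F0].
Unshelve. all: by end_near.
Qed.

Lemma finitely_supported_bound (V : nmodType) (A : nat -> V) :
  finitely_supported A -> exists N, forall n, (N <= n)%N -> A n = 0.
Proof.
move=> /finite_seqP[s As]; exists (\max_(i <- s) i).+1 => n n_big.
apply: contrapT => /eqP An0.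
have : ([set` s]%classic : set nat) n by rewrite -As.
by move=> /= ns; have := leq_bigmax_seq (F := id) n ns isT; rewrite leqNgt n_big.
Qed.

Lemma sqr_cabs (R : realType) (z : R[i]) : cabs z ^+ 2 = complex.Re z ^+ 2 + complex.Im z ^+ 2.
Proof. by case: z => a b; rewrite /cabs /= sqr_sqrtr // addr_ge0 ?sqr_ge0. Qed.

(* AM-GM: 2 |Re (x conj y)| <= t |x|^2 + |y|^2 / t *)
Lemma sqr_cabsB_ge (R : realType) (x y : R[i]) (t : R) : 0 < t ->
  (1 - t) * cabs x ^+ 2 + (1 - t^-1) * cabs y ^+ 2 <= cabs (x - y) ^+ 2.
Proof.
move=> t0; case: x y => [a b] [c d]; rewrite !sqr_cabs /= -subr_ge0.
set e := (X in 0 <= X).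
have -> : e = t^-1 * ((t * a - c) ^+ 2 + (t * b - d) ^+ 2).
  by rewrite /e; field; rewrite gt_eqF.
by rewrite mulr_ge0 ?invr_ge0 ?(ltW t0) // addr_ge0 ?sqr_ge0.
Qed.

(* [k n] stands for the ratio [u (n-1) / u n] of a positive supersolution
   [u]; the last summand on the left is the boundary term. *)
Lemma hardy_partial_sum (R : realType) (A : nat -> R[i]) (a k : nat -> R) (N : nat) :
  A 0%N = 0 -> (forall n, 0 <= a n) -> 0 <= k 1%N ->
  (forall n, 0 < k n.+2) ->
  \sum_(1 <= n < N.+1)
     (a n * (1 - k n) + a n.+1 * (1 - (k n.+1)^-1)) * cabs (A n) ^+ 2
  - a N.+1 * (1 - (k N.+1)^-1) * cabs (A N) ^+ 2
  <= \sum_(1 <= n < N.+1) a n * cabs (A n - A n.-1) ^+ 2.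
Proof.
move=> A0 a_ge0 k1_ge0 k_gt0.
have cabs0 : cabs (0 : R[i]) ^+ 2 = 0 by rewrite sqr_cabs /= expr0n /= addr0.
elim: N => [|N IHN]; first by rewrite !big_geq // A0 cabs0 mulr0 subr0.
rewrite !(big_nat_recr N.+1) //=.
(* The new boundary term cancels one half of the newly added weight; the other half joins the old
   boundary term. *)
suff : a N.+1 * (1 - k N.+1) * cabs (A N.+1) ^+ 2
     + a N.+1 * (1 - (k N.+1)^-1) * cabs (A N) ^+ 2
     <= a N.+1 * cabs (A N.+1 - A N) ^+ 2 by lra.
(* At index 1 the ratio [k 1] may be 0, which rules out AM-GM; [A 0 = 0] and [1 - k 1 <= 1]
   suffice. *)
case: N {IHN} => [|N].
  rewrite A0 cabs0 subr0 mulr0 addr0 ler_wpM2r ?sqr_ge0 //.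
  by rewrite ler_piMr // lerBlDr lerDl.
by rewrite -!mulrA -mulrDr ler_wpM2l // sqr_cabsB_ge.
Qed.

(** * The weights *)

Lemma S_gt0 (R : realType) (n : nat) : 0 < S_ R n.+1.
Proof. by rewrite divr_gt0 ?mulr_gt0. Qed.

Lemma w_supersolution (R : realType) (alpha : R) (n : nat) : (0 < n)%N ->
  let a m := S_ R m `^ alpha / m%:R in
  let k m := ((m%:R - 1) / m.+1%:R) `^ ((1 - alpha) / 2) in
  w_ alpha n = a n * (1 - k n) + a n.+1 * (1 - (k n.+1)^-1).
Proof.
case: n => // n _ a k; rewrite /w_ /a /k.
have n1 : 0 < n.+1%:R :> R by [].
have n2 : 0 < n.+2%:R :> R by [].
have n3 : 0 < n.+3%:R :> R by [].
have -> : S_ R n.+2 = S_ R n.+1 * (n.+3%:R / n.+1%:R).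
  by rewrite /S_; field; rewrite gt_eqF.
rewrite powRM ?(ltW (S_gt0 _ _)) ?divr_ge0 //.
have -> : (n.+2%:R - 1 : R) = n.+1%:R by rewrite -[n.+2%:R]natr1 addrK.
rewrite -powRN.
have -> : (n.+1%:R / n.+3%:R : R) `^ (- ((1 - alpha) / 2)) =
          (n.+3%:R / n.+1%:R) `^ ((1 - alpha) / 2).
  have -> : n.+1%:R / n.+3%:R = (n.+3%:R / n.+1%:R) `^ (-1) :> R.
    by rewrite powR_inv1 ?divr_ge0 // invf_div.
  by rewrite -powRrM mulrNN mul1r.
have -> : (1 + alpha) / 2 = alpha + (1 - alpha) / 2 by field.
rewrite [_ `^ (alpha + _)]powRD; last first.
  by apply/implyP => _; rewrite gt_eqF // divr_gt0.
by field; rewrite !gt_eqF.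
Qed.

Lemma w_factor_gt (R : realType) (alpha : R) (n : nat) :
  0 <= alpha -> alpha < 1 ->
  (alpha - 1) ^+ 2 / n.+2%:R ^+ 2 <
    1 + n.+1%:R / n.+2%:R * (n.+3%:R / n.+1%:R) `^ alpha
     - ((n.+1%:R - 1) / n.+2%:R) `^ ((1 - alpha) / 2)
     - n.+1%:R / n.+2%:R * (n.+3%:R / n.+1%:R) `^ ((1 + alpha) / 2).
Proof.
move=> alpha_ge0 alpha_lt1.
pose b := (1 - alpha) / 2.
have b_gt0 : 0 < b by rewrite /b; lra.
have b_le : b <= 1/2 by rewrite /b; lra.
have n1 : 0 < n.+1%:R :> R by [].
have n2 : 0 < n.+2%:R :> R by [].
have n3 : 0 < n.+3%:R :> R by [].
pose x : R := n.+2%:R^-1.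
have x_gt0 : 0 < x by rewrite invr_gt0.
have xp : 0 < 1 + x by rewrite addr_gt0.
have n1E : n.+1%:R = n.+2%:R - 1 :> R by rewrite -[n.+2%:R]natr1 addrK.
have n3E : n.+3%:R = n.+2%:R + 1 :> R by rewrite natr1.
have n12 : n.+1%:R / n.+2%:R = 1 - x by rewrite n1E /x; field; rewrite gt_eqF.
have xm : 0 < 1 - x by rewrite -n12 divr_gt0.
have n31 : n.+3%:R / n.+1%:R = ((1 - x) / (1 + x)) `^ (-1).
  rewrite powR_inv1 ?divr_ge0 ?ltW // -n12 n3E n1E /x; field.
  by have n0 := ler0n R n; apply/and3P; split; rewrite gt_eqF //; lra.
set r := (1 - x) / (1 + x) in n31.
have r_gt0 : 0 < r by rewrite divr_gt0.
have r_neq0 : r != 0 by rewrite gt_eqF.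
have -> : (n.+1%:R - 1) / n.+2%:R = 1 - 2 * x by rewrite n1E /x; field; rewrite gt_eqF.
have -> : (alpha - 1) ^+ 2 / n.+2%:R ^+ 2 = 4 * b ^+ 2 * x ^+ 2.
  by rewrite /b /x; field; rewrite gt_eqF.
rewrite n12 n31 -!powRrM -/b.
(* Since [alpha = 1 - 2 * b], all powers of [r] become powers of [z] times [r^-1], and
   [(1 - x) / r = 1 + x]. *)
have -> : -1 * alpha = b + b - 1 by rewrite /b; field.
have -> : -1 * ((1 + alpha) / 2) = b - 1 by rewrite /b; field.
rewrite !powRD ?r_neq0 ?implybT // powR_inv1 ?(ltW r_gt0) //.
set z := r `^ b.
have -> : (1 - x) * (z * z * r^-1) = (1 + x) * z ^+ 2.
  by rewrite /r; field; rewrite !gt_eqF.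
have -> : (1 - x) * (z * r^-1) = (1 + x) * z.
  by rewrite /r; field; rewrite !gt_eqF.
have [n0|n_gt0] := posnP n; last first.
  by apply: weight_ineq => //; rewrite /x mul1r lef_pV2 ?posrE // ler_nat.
(* Index 1 lies outside [x <= 1/3]. Here the right side is [1 + 3/2 * (z ^+ 2 - z) >= 5/8], while
   the left is [b ^+ 2 <= 1/4]. *)
have xE : x = 1/2 by rewrite /x n0 mul1r.
have -> : 1 - 2 * x = 0 by rewrite xE; lra.
rewrite powR0 ?gt_eqF // xE.
have : 0 <= (z - 1/2) ^+ 2 by exact: sqr_ge0.
have : b ^+ 2 <= 1/4 by nra.
lra.
Qed.

Lemma w_gt (R : realType) (alpha : R) (n : nat) :
  0 <= alpha -> alpha < 1 -> (0 < n)%N ->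
  (alpha - 1) ^+ 2 / 4 * (n%:R / S_ R n `^ (2 - alpha)) < w_ alpha n.
Proof.
case: n => // n alpha_ge0 alpha_lt1 _.
have S0 := S_gt0 R n.
have SE : S_ R n.+1 = n.+1%:R * n.+2%:R / 2 by [].
rewrite powRB; last by apply/implyP => _; rewrite gt_eqF.
rewrite powR_mulrn ?(ltW S0) //.
have -> : (alpha - 1) ^+ 2 / 4 * (n.+1%:R / (S_ R n.+1 ^+ 2 / S_ R n.+1 `^ alpha)) =
  S_ R n.+1 `^ alpha / n.+1%:R * ((alpha - 1) ^+ 2 / n.+2%:R ^+ 2).
  have Sa : S_ R n.+1 `^ alpha != 0 by rewrite gt_eqF ?powR_gt0.
  move: Sa; set Sa := _ `^ alpha => Sa0; rewrite SE -!natr1.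
  field.
  rewrite Sa0 /=; have n0 := ler0n R n.
  by apply/andP; split; rewrite gt_eqF //; lra.
by rewrite /w_ ltr_pM2l ?w_factor_gt // divr_gt0 ?powR_gt0.
Qed.

Theorem theorem3p4 (R : realType) (A : nat -> R[i])
    (A_fin : finitely_supported A) (A0 : A 0%N = 0)
    (alpha : R) (alpha_ge0 : 0 <= alpha) (alpha_lt1 : alpha < 1) :
  \sum_(1 <= n <oo) (S_ R n `^ alpha * cabs (A n - A n.-1) ^+ 2 / n%:R)
    >= \sum_(1 <= n <oo) (w_ alpha n * cabs (A n) ^+ 2)
  /\
  ((exists n : nat, A n <> 0) ->
   \sum_(1 <= n <oo) (w_ alpha n * cabs (A n) ^+ 2)
     > (alpha - 1) ^+ 2 / 4 *
       \sum_(1 <= n <oo) (n%:R / S_ R n `^ (2 - alpha) * cabs (A n) ^+ 2)).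
Proof.
have [N AN] := finitely_supported_bound A_fin.
have cabs0 : cabs (0 : R[i]) ^+ 2 = 0 by rewrite sqr_cabs /= expr0n /= addr0.
have fin (F : nat -> R) : \sum_(1 <= n <oo) (F n * cabs (A n) ^+ 2) =
    \sum_(1 <= n < N.+1) F n * cabs (A n) ^+ 2.
  by apply: series_finite_support => // n Nn; rewrite AN ?cabs0 ?mulr0 // ltnW.
split.
  (* The differences are only known to vanish from [N.+1] on; cutting there, [A N = 0] removes the
     boundary term. *)
  rewrite fin (@series_finite_support _ _ 1 N.+1) //; last first.
    by case=> // n Nn; rewrite !AN ?subr0 ?cabs0 ?mulr0 ?mul0r // ltnW.
  pose a m : R := S_ R m `^ alpha / m%:R.
  pose k m : R := ((m%:R - 1) / m.+1%:R) `^ ((1 - alpha) / 2).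
  have a_ge0 m : 0 <= a m by rewrite divr_ge0 ?powR_ge0.
  have k_gt0 m : 0 < k m.+2.
    by rewrite powR_gt0 // divr_gt0 // -[m.+2%:R]natr1 addrK.
  have := hardy_partial_sum N A0 a_ge0 (powR_ge0 _ _ : 0 <= k 1%N) k_gt0.
  rewrite AN // cabs0 mulr0 subr0.
  rewrite (@eq_big_nat _ _ _ _ _ _ (fun n => w_ alpha n * cabs (A n) ^+ 2)); last first.
    by move=> n /andP[n_gt0 _]; rewrite w_supersolution.
  by under [X in _ <= X -> _]eq_bigr do rewrite mulrAC.
(* All termwise gaps are nonnegative, and the one at [m] is positive. *)
case=> m /eqP Am; rewrite !fin mulr_sumr -subr_gt0 -sumrB.
have m_gt0 : (0 < m)%N by case: m Am => //; rewrite A0 eqxx.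
have mN : (m < N.+1)%N by rewrite ltnNge; apply: contra Am => Nm; rewrite AN // ltnW.
have cm : 0 < cabs (A m) ^+ 2.
  rewrite lt_neqAle sqr_ge0 andbT eq_sym expf_eq0 /=.
  by apply: contra Am => /eqP /ComplexField.Normc.eq0_normc ->.
have w_gap n : (0 < n)%N ->
    0 < w_ alpha n - (alpha - 1) ^+ 2 / 4 * (n%:R / S_ R n `^ (2 - alpha)).
  by move=> n_gt0; rewrite subr_gt0 w_gt.
rewrite (bigD1_seq m) ?iota_uniq ?mem_index_iota ?m_gt0 //=.
rewrite ltr_pwDl //; first by rewrite mulrA -mulrBl mulr_gt0 ?w_gap.
rewrite big_nat_cond; apply: sumr_ge0 => n /andP[/andP[n_gt0 _] _].
by rewrite mulrA -mulrBl mulr_ge0 ?sqr_ge0 ?(ltW (w_gap _ _)).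
Qed.
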